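(* Let $S$ be a set of $n>3$ points in general position in the plane with rectilinear crossing number $\overline{cr}(S)=\alpha\binom{n}{4}$. Then the Voronoi polynomial $p_V(z)=\sum_{k=1}^{n-1} v_k z^{k-1}$ of $S$ has a root of modulus at least \[ 1+\frac{(1-\alpha)\pi^2}{16(n-3)^2}+O\!\left(\frac{1}{n^4}\right). \]
   Context: General position means no three points of $S$ are collinear and no four points of $S$ are cocircular. $v_k$ is the number of vertices of the order-$k$ Voronoi diagram of $S$ (the subdivision of the plane into cells whose points share the same set of $k$ nearest points of $S$). $\overline{cr}(S)$ is the number of crossing pairs of edges in the straight-line drawing of $K_n$ on $S$ (equivalently, the number of convex quadrilaterals with vertices in $S$), so $0\le\alpha\le 1$. *)

(* Defs.v *)
From HB Require Import structures.
From mathcomp Require Export all_boot all_order all_algebra finmap.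
From mathcomp Require Export complex.
From mathcomp Require Export all_classical all_reals all_analysis.
Export Order.TTheory GRing.Theory Num.Theory numFieldNormedType.Exports.

Set Implicit Arguments.
Unset Strict Implicit.
Unset Printing Implicit Defensive.

Local Open Scope classical_set_scope.
Local Open Scope fset_scope.
Local Open Scope ring_scope.

(* The plane is R * R.  The library norm on a product is the max norm, so the
   Euclidean distance is defined explicitly; the product topology is the usual
   topology of the plane. *)
Definition edist (R : realType) (p q : R * R) : R :=
  Num.sqrt ((p.1 - q.1) ^+ 2 + (p.2 - q.2) ^+ 2).

Definition collinear (R : realType) (A : {fset R * R}) : Prop :=
  exists a b c : R, (a, b) <> (0, 0) /\
    forall p, p \in A -> a * p.1 + b * p.2 = c.

Definition cocircular (R : realType) (A : {fset R * R}) : Prop :=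
  exists (o : R * R) (r : R), forall p, p \in A -> edist p o = r.

Definition general_position (R : realType) (S : {fset R * R}) : Prop :=
  (forall A, A `<=` S -> #|` A| = 3%N -> ~ collinear A) /\
  (forall A, A `<=` S -> #|` A| = 4%N -> ~ cocircular A).

Definition edges (R : realType) (S : {fset R * R}) : {fset {fset R * R}} :=
  [fset e in fpowerset S | #|` e| == 2%N].

Definition open_segment (R : realType) (e : {fset R * R}) : set (R * R) :=
  [set x | exists p q t, e = [fset p; q] /\ 0 < t < 1 /\
     x = ((1 - t) * p.1 + t * q.1, (1 - t) * p.2 + t * q.2)].

(* Unordered pairs of distinct edges whose relative interiors meet; in general
   position, two such edges have no common endpoint. *)
Definition crossings (R : realType) (S : {fset R * R}) :
    {fset {fset {fset R * R}}} :=
  [fset P in fpowerset (edges S) | (#|` P| == 2%N) &&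
     `[< exists e f, P = [fset e; f] /\
           (open_segment e `&` open_segment f)%classic !=set0 >]].

Definition crossing_number (R : realType) (S : {fset R * R}) : nat :=
  #|` crossings S|.

(* The open cell of A: the points whose set of k nearest points of S is A. *)
Definition voronoi_cell (R : realType) (S : {fset R * R}) (k : nat)
    (A : {fset R * R}) : set (R * R) :=
  [set x | A `<=` S /\ #|` A| = k /\
     forall p q, p \in A -> q \in S -> q \notin A -> edist x p < edist x q].

(* The cells are convex, so the vertices of the subdivision are exactly the
   points incident to at least three cells. *)
Definition voronoi_vertices (R : realType) (S : {fset R * R}) (k : nat) :
    set (R * R) :=
  [set x | exists A B C : {fset R * R}, [/\ A <> B, B <> C & A <> C] /\
     [/\ closure (voronoi_cell S k A) x, closure (voronoi_cell S k B) x
       & closure (voronoi_cell S k C) x]].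

(* This set of vertices is finite; [fset_set] is the empty set on infinite
   sets. *)
Definition num_voronoi_vertices (R : realType) (S : {fset R * R})
    (k : nat) : nat :=
  #|` fset_set (voronoi_vertices S k)|.

Definition voronoi_poly (R : realType) (S : {fset R * R}) : {poly R[i]} :=
  \sum_(1 <= k < #|` S|) (num_voronoi_vertices S k)%:R *: 'X^(k.-1).

(* Main.v *)
(* For a triple T of S let i(T) be the number of points of S inside the circle
   through T.  The vertices of the order-k Voronoi diagram are exactly the
   centres of the triples with i(T) = k - 1 or i(T) = k - 2, so that
   p_V(z) = (1 + z) P(z) with P(z) = \sum_T z^i(T), of degree n - 3.
   A four-point set contributes 2 to \sum_T i(T) if it is in convex position and
   1 otherwise, so P'(1) / P(1) <= (1 + alpha) (n - 3) / 4.  As P'(1) / P(1) is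
   the sum of 1 / (1 - z) over the n - 3 roots z of P, some root satisfies
   Re (1 / (1 - z)) <= (1 + alpha) / 4, that is,
   |z|^2 - 1 >= (1 - alpha) / 2 * |1 - z|^2.  The coefficients of P being
   nonnegative, no root has argument smaller than t = pi / (2 (n - 3)), hence
   |1 - z|^2 >= 2 (1 - cos t), and t^2 / 4 = pi^2 / (16 (n - 3)^2). *)

Require Import Defs.
From mathcomp Require Import ring lra zify.

Set Implicit Arguments.
Unset Strict Implicit.
Unset Printing Implicit Defensive.

Local Open Scope classical_set_scope.
Local Open Scope fset_scope.
Local Open Scope complex_scope.
Local Open Scope ring_scope.

Local Notation Re := complex.Re.
Local Notation Im := complex.Im.

(** * A root of large modulus *)

(** Half-angle formula [1 - cos x = 2 sin(x/2)^2], with [|sin y| <= y] from the mean value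
    theorem. *)
Lemma cos_ge_quadratic (R : realType) (x : R) : 0 <= x -> 1 - cos x <= x ^+ 2 / 2.
Proof.
move=> x0.
have sin_le (y : R) : 0 <= y -> `|sin y| <= y.
  rewrite le_eqVlt => /predU1P[<-|y0]; first by rewrite sin0 normr0.
  have [c _] := @MVT _ (@sin R) (@cos R) 0 y y0
    (fun x _ => is_derive_sin x) (continuous_subspaceT (@continuous_sin R)).
  rewrite sin0 !subr0 => ->; rewrite normrM (gtr0_norm y0).
  by rewrite ler_piMl ?cos_max// ltW.
have /sin_le h : 0 <= x / 2 by rewrite divr_ge0.
have e : x = (x / 2) *+ 2 by rewrite mulr2n; lra.
rewrite [in cos x]e cos_mulr2n cos2sin2.
have : `|sin (x / 2)| ^+ 2 <= (x / 2) ^+ 2.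
  by rewrite ler_pXn2r// nnegrE ?divr_ge0.
rewrite real_normK ?num_real//; move: (sin _ ^+ 2) => p.
by rewrite expr_div_n; rewrite [(1 - p) *+ 2]mulr2n (_ : 2 ^+ 2 = 4) -?natrX//; move: (x ^+ 2) => q; lra.
Qed.

(** By the mean value theorem [sin x = x cos c] with [0 < c < x], and [cos c >= 1 - x^2/2]. *)
Lemma sin_ge_cubic (R : realType) (x : R) : 0 <= x -> x - x ^+ 3 / 2 <= sin x.
Proof.
rewrite le_eqVlt => /predU1P[<-|x0].
  by rewrite sin0 expr0n /= mul0r subr0.
have [c] := @MVT _ (@sin R) (@cos R) 0 x x0
  (fun x _ => is_derive_sin x) (continuous_subspaceT (@continuous_sin R)).
rewrite in_itv /= => /andP[c0 cx]; rewrite sin0 !subr0 => ->.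
have := cos_ge_quadratic (ltW c0).
have : c ^+ 2 <= x ^+ 2 by rewrite ler_pXn2r// ?nnegrE ?ltW.
move=> h1 h2.
have h : 1 - x ^+ 2 / 2 <= cos c by lra.
have := ler_wpM2r (ltW x0) h; rewrite mulrBl mul1r => h3; apply: le_trans h3.
by rewrite (_ : x ^+ 3 = x ^+ 2 * x); [lra|ring].
Qed.

(** The cubic bound for [sin (t/2)] is squared, dropping the square [(t^3/16)^2]; [t <= 2] makes the
    bound nonnegative, so that squaring preserves the order. *)
Lemma cos_le_quartic (R : realType) (t : R) : 0 <= t -> t <= 2 ->
  t ^+ 2 / 2 - t ^+ 4 / 8 <= 1 - cos t.
Proof.
move=> t0 t2.
have e : t = (t / 2) *+ 2 by rewrite mulr2n; lra.
rewrite [in cos t]e cos_mulr2n cos2sin2.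
have /sin_ge_cubic h : 0 <= t / 2 by rewrite divr_ge0.
have h0 : 0 <= t / 2 - (t / 2) ^+ 3 / 2.
  have -> : t / 2 - (t / 2) ^+ 3 / 2 = t / 2 * (1 - t ^+ 2 / 8) by field.
  by apply: mulr_ge0; [lra|nra].
have : (t / 2 - (t / 2) ^+ 3 / 2) ^+ 2 <= sin (t / 2) ^+ 2.
  by rewrite ler_pXn2r// nnegrE (le_trans h0).
have : t ^+ 2 / 4 - t ^+ 4 / 16 <= (t / 2 - (t / 2) ^+ 3 / 2) ^+ 2.
  have -> : (t / 2 - (t / 2) ^+ 3 / 2) ^+ 2
    = t ^+ 2 / 4 - t ^+ 4 / 16 + (t ^+ 3 / 16) ^+ 2 by field.
  by rewrite lerDl sqr_ge0.
move: (_ ^+ 2) (sin _ ^+ 2) => p q h1 h2.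
rewrite [(1 - q) *+ 2]mulr2n; move: (t ^+ 4) h1 => v; lra. 
Qed.

(** The logarithmic derivative of a split polynomial, by induction with the product rule. *)
Lemma deriv_prod_XsubC_at (F : fieldType) (x : F) (rs : seq F) : x \notin rs ->
  let Q := \prod_(z <- rs) ('X - z%:P) in
  Q^`().[x] = Q.[x] * \sum_(z <- rs) (x - z)^-1.
Proof.
elim: rs => [|z rs IH] /=; first by rewrite !big_nil derivC horner0 mulr0.
rewrite inE negb_or => /andP[xz /IH e].
rewrite !big_cons derivM derivXsubC mul1r !hornerE e.
by rewrite mulrDr [_ * _ * _^-1]mulrAC divff ?subr_eq0// mul1r !mulrA.
Qed.

Lemma Re_invc1B (R : realType) (z : R[i]) : z != 1 ->
  let q := (1 - Re z) ^+ 2 + Im z ^+ 2 in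
  0 < q /\ Re (1 - z)^-1 = (1 - Re z) / q.
Proof.
case: z => x y; rewrite eq_complex /= => h; split; last first.
  by rewrite sub0r sqrrN.
rewrite lt0r addr_ge0 ?sqr_ge0// andbT paddr_eq0 ?sqr_ge0// !sqrf_eq0.
by rewrite subr_eq0 eq_sym.
Qed.

(** De Moivre's formula. The sign [s] accounts for the two half-planes, so that [t] may come from
    [acos] and lie in [[0, pi]]. *)
Lemma Re_exprc_polar (R : realType) (r t s : R) (k : nat) : s ^+ 2 = 1 ->
  ((r * cos t) +i* (s * (r * sin t)) : R[i]) ^+ k =
  (r ^+ k * cos (k%:R * t)) +i* (s * (r ^+ k * sin (k%:R * t))).
Proof.
move=> s2; elim: k => [|k IH].
  by rewrite !expr0 mul0r cos0 sin0 !mulr0 mulr1.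
rewrite exprS IH -natr1 mulrDl mul1r cosD sinD exprS.
apply/eqP; rewrite eq_complex /=; apply/andP; split; apply/eqP; last by ring.
rewrite (_ : r * cos t * _ - _ = r * r ^+ k * (cos (k%:R * t) * cos t
   - s ^+ 2 * (sin (k%:R * t) * sin t))); last by ring.
by rewrite s2; ring.
Qed.

Lemma Re_sum (R : realType) (I : Type) (r : seq I) (Q : pred I) (F : I -> R[i]) :
  Re (\sum_(i <- r | Q i) F i) = \sum_(i <- r | Q i) Re (F i).
Proof. by apply: (big_morph (@complex.Re R)) => // -[a b] [c d]. Qed.

Section SparsePoly.
Variables (R : realType) (I : finType) (A : {pred I}) (e : I -> nat).
Let P : {poly R[i]} := \sum_(T in A) 'X^(e T).

(* Below this angle every term [z ^+ e T] has positive real part. *)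
Lemma root_sum_Xn_arg (d : nat) (z : R[i]) : (0 < d)%N ->
  (forall T, T \in A -> (e T <= d)%N) -> (exists T, T \in A) ->
  root P z -> 1 <= `|z| -> Re z <= Re `|z| * cos (pi / (2 * d%:R)).
Proof.
move=> d0 ed [T0 AT0] + z1; have d0' : 0 < d%:R :> R by rewrite ltr0n.
rewrite normc_def /=; set r := Num.sqrt _.
have r2 : r ^+ 2 = Re z ^+ 2 + Im z ^+ 2 by rewrite sqr_sqrtr ?addr_ge0 ?sqr_ge0.
have r1 : 1 <= r by move: z1; rewrite normc_def lecR.
have r0 : 0 < r by lra.
rewrite leNgt => rt; apply/negP => cl.
have cI : -1 <= Re z / r <= 1.
  by rewrite ler_pdivlMr// ler_pdivrMr//; apply/andP; split; nra.
set t := acos (Re z / r).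
have ct : r * cos t = Re z by rewrite acosK ?itv_boundlr//= mulrC divfK ?gt_eqF.
have t0 : 0 <= t by rewrite acos_ge0.
have tpi : t <= pi by rewrite acos_lepi.
have pi0 := pi_gt0 R.
have d1 : 1 <= d%:R :> R by rewrite ler1n.
have td : t < pi / (2 * d%:R).
  rewrite -ltr_cos ?in_itv /= ?t0 ?tpi//.
    by rewrite -(ltr_pM2l r0) ct.
  rewrite divr_ge0 ?(ltW pi0) ?mulr_ge0//=.
  by rewrite ler_pdivrMr; nra.
pose s : R := if 0 <= Im z then 1 else -1.
have s2 : s ^+ 2 = 1 by rewrite /s; case: ifP; rewrite ?expr1n// sqrrN expr1n.
have sz : z = (r * cos t) +i* (s * (r * sin t)).
  have sin0 : 0 <= sin t by rewrite sin_ge0_pi// t0.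
  have sI : Im z = s * (r * sin t).
    have h : `|Im z| = r * sin t.
      apply/eqP; rewrite -(@eqrXn2 _ 2)//; last by rewrite mulr_ge0// ltW.
      rewrite real_normK ?num_real// exprMn sin2cos2 mulrBr mulr1 -exprMn ct r2.
      by apply/eqP; ring.
    by rewrite -h /s; case: ifP => [/ger0_norm->|/negbT];
       rewrite ?mul1r// -ltNge => /ltr0_norm->; ring.
  by case: (z) ct sI => x y /= -> <-.
move: rt; rewrite /root /P horner_sum => /eqP /(congr1 (@Re R)) /=.
rewrite Re_sum /=.
(* The real part of [P.[z]] is a sum of positive terms, so it cannot vanish. *)
apply/eqP; rewrite gt_eqF//.
have pos T : T \in A -> 0 < Re ('X^(e T)).[z].
  move=> AT; rewrite hornerXn sz Re_exprc_polar//= mulr_gt0 ?exprn_gt0//.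
  apply: cos_gt0_pihalf; have ed' : (e T)%:R <= d%:R :> R by rewrite ler_nat ed.
  have eT0 : 0 <= (e T)%:R :> R by [].
  have : t * (2 * d%:R) < pi by rewrite -ltr_pdivlMr//; lra.
  by move=> ?; apply/andP; split; nra.
rewrite (bigD1 T0)//= ltr_pwDl ?pos// sumr_ge0// => T /andP[AT _].
exact/ltW/pos.
Qed.

(** The hypothesis on the sum bounds the mean exponent [P'(1)/P(1)] by [(1 + a) d / 4]. The
    fourth-power term pays for the quartic error of the cosine and for passing from [|z|^2] to
    [|z|]. *)
Lemma large_root_sum_Xn (d : nat) (a : R) : (0 < d)%N ->
  (forall T, T \in A -> (e T <= d)%N) -> (exists2 T, T \in A & e T = d) ->
  0 <= a <= 1 -> 4 * (\sum_(T in A) (e T)%:R) <= (1 + a) * d%:R * #|A|%:R ->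
  exists z : R[i], root P z /\
    (1 + (1 - a) * pi ^+ 2 / (16 * d%:R ^+ 2) - (pi / (2 * d%:R)) ^+ 4)%:C <= `|z|.
Proof.
move=> d0 ed [T0 AT0 eT0] /andP[a0 a1] hsum.
have d0' : 0 < d%:R :> R by rewrite ltr0n.
have A0 : (0 < #|A|)%N by apply/card_gt0P; exists T0.
have P1 : P.[1] = #|A|%:R.
  rewrite horner_sum (eq_bigr (fun=> 1)) ?sumr_const// => T _.
  by rewrite hornerXn expr1n.
have P1' : P^`().[1] = \sum_(T in A) (e T)%:R.
  rewrite raddf_sum horner_sum; apply: eq_bigr => T _ /=.
  by rewrite derivXn hornerMn hornerXn expr1n.
(* The coefficient of ['X^d] counts the [T] with [e T = d], and there is one. *)
have sP : size P = d.+1.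
  apply/eqP; rewrite eqn_leq; apply/andP; split.
    apply: (leq_trans (size_sum _ _ _)); apply/bigmax_leqP => T AT.
    by rewrite size_polyXn ltnS ed.
  rewrite ltnNge; apply/negP => /leq_sizeP /(_ d (leqnn _)) /eqP.
  rewrite coef_sum (eq_bigr (fun T => (d == e T)%:R)); last by move=> T _; rewrite coefXn.
  by rewrite -natr_sum pnatr_eq0 (bigD1 T0)//= eT0 eqxx.
have [rs Prs] := closed_field_poly_normal P.
have lc0 : lead_coef P != 0 by rewrite lead_coef_eq0 -size_poly_eq0 sP.
have srs : size rs = d.
  by move: sP; rewrite Prs size_scale// size_prod_XsubC => -[].
have rsP z : z \in rs -> root P z.
  by rewrite Prs rootZ// root_prod_XsubC.
have n1 : 1 \notin rs.
  by apply/negP => /rsP; rewrite /root P1 pnatr_eq0 => /eqP h; rewrite h in A0.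
have key : \sum_(z <- rs) Re (1 - z)^-1 = (\sum_(T in A) (e T)%:R) / #|A|%:R.
  have : P^`().[1] = P.[1] * \sum_(z <- rs) (1 - z)^-1.
    by rewrite Prs derivZ !hornerZ (deriv_prod_XsubC_at n1) mulrA.
  rewrite P1 P1' => /(congr1 (fun w => Re (w / #|A|%:R))).
  rewrite [_ * _ / _]mulrAC divff ?mul1r ?pnatr_eq0 -?lt0n// Re_sum.
  move=> <-; rewrite -natr_sum.
  rewrite -(rmorph_nat (real_complex R)) -(rmorph_nat (real_complex R) #|A|).
  by rewrite -fmorphV -rmorphM /= natr_sum.
(* Pigeonhole: the [d] real parts add up to at most [d (1 + a) / 4]. *)
have [z zrs hz] : exists2 z, z \in rs & Re (1 - z)^-1 <= (1 + a) / 4.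
  apply: contrapT => hn.
  have hlt z : z \in rs -> (1 + a) / 4 < Re (1 - z)^-1.
    by move=> zrs; rewrite ltNge; apply/negP => h; apply: hn; exists z.
  have : \sum_(z <- rs) (1 + a) / 4 < \sum_(z <- rs) Re (1 - z)^-1.
    rewrite big_seq [X in _ < X]big_seq; apply: ltr_sum => //.
    by apply/hasP; exists (head 0 rs); case: (rs) srs d0 => [<-|w l]//= _ _;
       rewrite inE eqxx.
  rewrite key big_const_seq count_predT srs iter_addr_0 ltNge => /negP; apply.
  rewrite ler_pdivrMr ?ltr0n// -mulr_natl; nra.
exists z; split; first exact: rsP.
have z1 : z != 1 by apply: contraNneq n1 => <-.
have [q0 qE] := Re_invc1B z1; move: hz; rewrite {}qE ler_pdivrMr//.
set q := (1 - Re z) ^+ 2 + Im z ^+ 2 => hq.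
have argz := root_sum_Xn_arg d0 ed (ex_intro _ T0 AT0) (rsP z zrs).
move: argz; rewrite normc_def lecR /=; set r := Num.sqrt _ => argz.
have r2 : r ^+ 2 = Re z ^+ 2 + Im z ^+ 2 by rewrite sqr_sqrtr ?addr_ge0 ?sqr_ge0.
have r0 : 0 <= r by rewrite sqrtr_ge0.
have qr : q = 1 - 2 * Re z + r ^+ 2 by rewrite r2 /q; ring.
(* Here [q = |1 - z|^2], and [hq] bounds [1 - Re z], which equals [(q + 1 - r^2) / 2]. *)
have hr2 : (1 - a) / 2 * q <= r ^+ 2 - 1 by rewrite qr in hq *; lra.
have r1 : 1 <= r.
  rewrite -(@ler_pXn2r _ 2)// ?nnegrE// expr1n -subr_ge0.
  by apply: le_trans hr2; apply: mulr_ge0; [lra|exact: ltW q0].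
move: (argz r1) => {}argz; rewrite lecR.
have pi0 := pi_gt0 R.
set t := pi / (2 * d%:R) in argz *.
have t0 : 0 <= t by rewrite divr_ge0 ?mulr_ge0 ?ltW.
have t2 : t <= 2.
  have d1 : 1 <= d%:R :> R by rewrite ler1n.
  have := pihalf_lt2 R; rewrite /t ler_pdivrMr; nra.
have -> : (1 - a) * pi ^+ 2 / (16 * d%:R ^+ 2) = (1 - a) * t ^+ 2 / 4.
  by rewrite /t; field; rewrite gt_eqF.
have ct := cos_le_quartic t0 t2.
(* As [Re z <= r cos t], [q] is at least [(r - 1)^2 + 2 r (1 - cos t)], and [r >= 1]. *)
have qt : 2 * (1 - cos t) <= q by rewrite qr; nra.
have hr3 : 1 + (1 - a) * (t ^+ 2 / 2 - t ^+ 4 / 8) <= r ^+ 2 by nra.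
have t4 : 0 <= t ^+ 4 by rewrite exprn_ge0.
(* If the correction is nonpositive, [r >= 1] is enough. Otherwise both sides are squared, and the
   square of the correction is at most [t^4 / 16]. *)
have [s0|s0] := leP ((1 - a) * t ^+ 2 / 4 - t ^+ 4) 0; first by lra.
rewrite -(@ler_pXn2r _ 2)// ?nnegrE//; last by lra.
apply: le_trans hr3.
set s := (1 - a) * t ^+ 2 / 4 in s0 *.
have tt0 : 0 <= t ^+ 2 by rewrite exprn_ge0.
have e4 : t ^+ 4 = (t ^+ 2) ^+ 2 by rewrite -exprM.
have s4 : s <= t ^+ 2 / 4 by rewrite /s; nra.
have ss : (s - t ^+ 4) ^+ 2 <= t ^+ 4 / 16 by rewrite {2}e4; nra.
have -> : (1 + s - t ^+ 4) ^+ 2 = 1 + 2 * (s - t ^+ 4) + (s - t ^+ 4) ^+ 2 by ring.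
have at4 : (1 - a) * t ^+ 4 <= t ^+ 4 by nra.
rewrite /s in ss *; lra.
Qed.
End SparsePoly.

(** * Circles through points of the plane *)

Section Plane.
Variable R : realType.
Implicit Types p q r s o x : R * R.

Definition sqdist p q : R := (p.1 - q.1) ^+ 2 + (p.2 - q.2) ^+ 2.

Lemma sqdist_ge0 p q : 0 <= sqdist p q.
Proof. by rewrite addr_ge0 ?sqr_ge0. Qed.

Lemma sqdistC p q : sqdist p q = sqdist q p.
Proof. by rewrite /sqdist; ring. Qed.

Lemma sqdist_gt0 p q : p != q -> 0 < sqdist p q.
Proof.
move=> pq; rewrite lt0r sqdist_ge0 andbT; apply: contra pq.
rewrite paddr_eq0 ?sqr_ge0// !sqrf_eq0 !subr_eq0 => /andP[/eqP h1 /eqP h2].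
by apply/eqP; case: p q h1 h2 => [a b] [c d] /= -> ->.
Qed.

Lemma ler_edist o p o' q : (edist o p <= edist o' q) = (sqdist o p <= sqdist o' q).
Proof. by rewrite /edist ler_sqrt ?sqdist_ge0. Qed.

Lemma ltr_edist o p o' q : (edist o p < edist o' q) = (sqdist o p < sqdist o' q).
Proof. by rewrite !ltNge ler_edist. Qed.

Definition orient p q r : R :=
  (q.1 - p.1) * (r.2 - p.2) - (q.2 - p.2) * (r.1 - p.1).

(* The signed minors [orient] are the coefficients of the affine dependency of
   p, q, r, s; hence this sum takes the same value at every [o], and at the
   centre of the circle through three of the points only one term survives,
   up to subtracting the squared radius. *)
Definition incircle o p q r s : R :=
  orient q r s * sqdist o p - orient p r s * sqdist o q
  + orient p q s * sqdist o r - orient p q r * sqdist o s.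

Lemma incircle_indep o o' p q r s : incircle o p q r s = incircle o' p q r s.
Proof. by rewrite /incircle /orient /sqdist; ring. Qed.

Lemma incircle_center o o' p q r s (d : R) :
  sqdist o q = d -> sqdist o r = d -> sqdist o s = d ->
  incircle o' p q r s = orient q r s * (sqdist o p - d).
Proof.
move=> hq hr hs; rewrite (incircle_indep _ o) /incircle hq hr hs.
by rewrite /orient; ring.
Qed.

Lemma incircle_swap o p q r s : incircle o q p r s = - incircle o p q r s.
Proof. by rewrite /incircle /orient; ring. Qed.

Lemma orient_swap p q r : orient q p r = - orient p q r.
Proof. by rewrite /orient; ring. Qed.

(** Cramer's rule for the equations of two perpendicular bisectors; [(u, v)] is the centre relative
    to [p]. *)
Lemma exists_circumcenter p q r : orient p q r != 0 ->
  exists o, sqdist o p = sqdist o q /\ sqdist o p = sqdist o r.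
Proof.
move=> h.
pose bq : R := (q.1 - p.1) ^+ 2 + (q.2 - p.2) ^+ 2.
pose br : R := (r.1 - p.1) ^+ 2 + (r.2 - p.2) ^+ 2.
pose u : R := (bq * (r.2 - p.2) - br * (q.2 - p.2)) / (2 * orient p q r).
pose v : R := ((q.1 - p.1) * br - (r.1 - p.1) * bq) / (2 * orient p q r).
exists (p.1 + u, p.2 + v); split.
- have : 2 * (u * (q.1 - p.1) + v * (q.2 - p.2)) = bq.
    by rewrite /u /v /bq /br /orient in h *; field.
  by rewrite /sqdist /bq /= => e; lra.
- have : 2 * (u * (r.1 - p.1) + v * (r.2 - p.2)) = br.
    by rewrite /u /v /bq /br /orient in h *; field.
  by rewrite /sqdist /br /= => e; lra.
Qed.

(** The vector [o - o'] is orthogonal to the independent vectors [q - p] and [r - p]. *)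
Lemma circumcenter_unique o o' p q r : orient p q r != 0 ->
  sqdist o p = sqdist o q -> sqdist o p = sqdist o r ->
  sqdist o' p = sqdist o' q -> sqdist o' p = sqdist o' r -> o = o'.
Proof.
move=> h h1 h2 h3 h4.
have e1 : (o.1 - o'.1) * (q.1 - p.1) + (o.2 - o'.2) * (q.2 - p.2) = 0.
  by rewrite /sqdist in h1 h3; lra.
have e2 : (o.1 - o'.1) * (r.1 - p.1) + (o.2 - o'.2) * (r.2 - p.2) = 0.
  by rewrite /sqdist in h2 h4; lra.
have f1 : orient p q r * (o.1 - o'.1) = 0.
  transitivity ((r.2 - p.2) * ((o.1 - o'.1) * (q.1 - p.1) + (o.2 - o'.2) * (q.2 - p.2))
     - (q.2 - p.2) * ((o.1 - o'.1) * (r.1 - p.1) + (o.2 - o'.2) * (r.2 - p.2))).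
    by rewrite /orient; ring.
  by rewrite e1 e2 !mulr0 subr0.
have f2 : orient p q r * (o.2 - o'.2) = 0.
  transitivity ((q.1 - p.1) * ((o.1 - o'.1) * (r.1 - p.1) + (o.2 - o'.2) * (r.2 - p.2))
     - (r.1 - p.1) * ((o.1 - o'.1) * (q.1 - p.1) + (o.2 - o'.2) * (q.2 - p.2))).
    by rewrite /orient; ring.
  by rewrite e1 e2 !mulr0 subr0.
move/eqP: f1; move/eqP: f2; rewrite !mulf_eq0 (negbTE h) /= !subr_eq0.
by case: o o' {h1 h2 h3 h4 e1 e2} => [a b] [c d] /= /eqP -> /eqP ->.
Qed.

(** Cramer's rule again. Moving along [v] changes the distance to [p] relative to those to [q] and
    [r] at prescribed rates, which breaks ties at a circumcentre. *)
Lemma exists_direction p q r (a b : R) : orient p q r != 0 ->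
  exists v, v.1 * (p.1 - q.1) + v.2 * (p.2 - q.2) = a /\
            v.1 * (p.1 - r.1) + v.2 * (p.2 - r.2) = b.
Proof.
move=> h; exists ((b * (q.2 - p.2) - a * (r.2 - p.2)) / orient p q r,
                  (a * (r.1 - p.1) - b * (q.1 - p.1)) / orient p q r).
by split; rewrite /orient /= in h *; field.
Qed.

Definition in_circ p q r s : Prop := exists o,
  [/\ sqdist o q = sqdist o r, sqdist o q = sqdist o s & sqdist o p < sqdist o q].

(** By [incircle_center] the product is the square of the orientation times a negative number. *)
Lemma in_circ_sign o p q r s : orient q r s != 0 -> in_circ p q r s ->
  incircle o p q r s * orient q r s < 0.
Proof.
move=> h [c [e1 e2 lt1]].
rewrite (@incircle_center c o p q r s (sqdist c q))// mulrAC -expr2.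
by rewrite pmulr_rlt0 ?subr_lt0// exprn_even_gt0.
Qed.

(* Evaluating [incircle] at s itself, one term vanishes and the others are
   positive multiples of the coefficients. *)
Lemma incircle_third_sign o p q r s : p != s -> q != s -> r != s ->
  let D := incircle o p q r s in
  D * orient q r s < 0 -> 0 < D * orient p r s -> 0 < D * orient p q s.
Proof.
move=> ps qs rs D hp hq.
have hD : D = orient q r s * sqdist s p - orient p r s * sqdist s q
    + orient p q s * sqdist s r.
  rewrite /D (incircle_indep _ s) /incircle (_ : sqdist s s = 0) ?mulr0 ?subr0//.
  by rewrite /sqdist !subrr expr0n /= addr0.
have sp : 0 < sqdist s p by rewrite sqdist_gt0 // eq_sym.
have sq : 0 < sqdist s q by rewrite sqdist_gt0 // eq_sym.
have sr : 0 < sqdist s r by rewrite sqdist_gt0 // eq_sym.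
rewrite -(pmulr_lgt0 _ sr) -mulrA.
have D2 : 0 <= D ^+ 2 by rewrite sqr_ge0.
have h1 : D * orient q r s * sqdist s p < 0 by rewrite pmulr_llt0.
have h2 : 0 < D * orient p r s * sqdist s q by rewrite pmulr_lgt0.
have -> : D * (orient p q s * sqdist s r) = D ^+ 2
  - D * orient q r s * sqdist s p + D * orient p r s * sqdist s q.
  by rewrite expr2 {3}hD; ring.
lra.
Qed.

Definition segments_meet p q r s : Prop := exists a b : R,
  [/\ 0 < a < 1, 0 < b < 1, (1 - a) * p.1 + a * q.1 = (1 - b) * r.1 + b * s.1
    & (1 - a) * p.2 + a * q.2 = (1 - b) * r.2 + b * s.2].

(** The affine dependency reads [- x p + y q = u r - w s], with four positive weights of equal total
    [y - x = u - w] on each side; dividing by that total gives the common point. *)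
Lemma segments_meet_signs (D : R) p q r s :
  D * orient q r s < 0 -> 0 < D * orient p r s ->
  0 < D * orient p q s -> D * orient p q r < 0 -> segments_meet p q r s.
Proof.
set x := D * orient q r s; set y := D * orient p r s.
set u := D * orient p q s; set w := D * orient p q r => x0 y0 u0 w0.
have yx : 0 < y - x by lra.
have exy : y - x = u - w by rewrite /x /y /u /w /orient; ring.
have e1 : - x * p.1 + y * q.1 = u * r.1 - w * s.1.
  by rewrite /x /y /u /w /orient; ring.
have e2 : - x * p.2 + y * q.2 = u * r.2 - w * s.2.
  by rewrite /x /y /u /w /orient; ring.
have n0 : y - x != 0 by rewrite gt_eqF.
clearbody x y u w.
exists (y / (y - x)), (- w / (y - x)).
have f (c d : R) : (1 - y / (y - x)) * c + y / (y - x) * d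
    = (- x * c + y * d) / (y - x) by field.
have g (c d : R) : (1 - - w / (y - x)) * c + - w / (y - x) * d
    = (u * c - w * d) / (y - x).
  by have -> : u = y - x + w; [lra|field].
by rewrite !f !g e1 e2; split=> //; rewrite ltr_pdivlMr// ltr_pdivrMr//; apply/andP; split; lra.
Qed.

(** The two containments fix the signs of two orientations relative to [incircle], and
    [incircle_third_sign] then fixes the other two. This is the sign pattern of a crossing, and it
    contradicts [in_circ_sign] for [r] and for [s]. *)
Lemma two_in_circ p q r s : p != s -> q != s -> p != r -> q != r -> r != s ->
  orient q r s != 0 -> orient p r s != 0 -> orient p q s != 0 -> orient p q r != 0 ->
  in_circ p q r s -> in_circ q p r s ->
  [/\ segments_meet p q r s, ~ in_circ r p q s & ~ in_circ s p q r].
Proof.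
move=> ps qs pr qr rs a0 b0 c0 d0 /(in_circ_sign p a0) a /(in_circ_sign p b0).
rewrite incircle_swap mulNr oppr_lt0 => b.
have c := incircle_third_sign ps qs rs a b.
have eD : incircle p p q s r = - incircle p p q r s.
  by rewrite /incircle /orient; ring.
have d : incircle p p q r s * orient p q r < 0.
  rewrite -oppr_gt0 -mulNr -eD; apply: incircle_third_sign => //.
  - by rewrite eq_sym.
  - by rewrite eD (_ : orient q s r = - orient q r s) ?mulrNN// /orient; ring.
  - by rewrite eD (_ : orient p s r = - orient p r s) ?mulrNN// /orient; ring.
split; first exact: segments_meet_signs a b c d.
- move=> /(in_circ_sign p c0); rewrite (_ : incircle p r p q s = incircle p p q r s).
    by move=> /lt_trans/(_ c); rewrite ltxx.
  by rewrite /incircle /orient; ring.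
- move=> /(in_circ_sign p d0); rewrite (_ : incircle p s p q r = - incircle p p q r s).
    by rewrite mulNr oppr_lt0 => /lt_trans/(_ d); rewrite ltxx.
  by rewrite /incircle /orient; ring.
Qed.

(* The quadratic form vanishing at p and q can replace the distances in
   [incircle], since it differs from them by an affine function. *)
Lemma incircle_diameter o p q r s :
  let f x := (x.1 - p.1) * (x.1 - q.1) + (x.2 - p.2) * (x.2 - q.2) in
  incircle o s p q r = orient p q r * f s - orient p q s * f r.
Proof. by rewrite /= /incircle /orient /sqdist; ring. Qed.
End Plane.

(** * Triples of a finite configuration *)

Section PointConfiguration.
Variables (R : realType) (K : finType) (pos : K -> R * R).
Hypothesis pos_inj : injective pos.
Hypothesis no_collinear : forall i j k, uniq [:: i; j; k] ->
  orient (pos i) (pos j) (pos k) != 0.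
Hypothesis no_cocircular : forall o (d : R) (A : {set K}),
  (forall i, i \in A -> sqdist o (pos i) = d) -> (#|A| <= 3)%N.
Implicit Types (i j k l : K) (T Q A : {set K}).

Lemma cards3E T : #|T| = 3%N ->
  exists i j k, uniq [:: i; j; k] /\ T = [set i; j; k]%SET.
Proof.
move=> cT; have /card_gt0P[i iT] : (0 < #|T|)%N by rewrite cT.
have : #|T :\ i| == 2%N by rewrite -(eqn_add2l (i \in T)) -cardsD1 cT iT.
case/cards2P => j [k [jk e]]; exists i, j, k.
have ijk x : x \in [set j; k]%SET -> x != i by rewrite -e !inE => /andP[].
split; last by rewrite -(finset.setD1K iT) e finset.setUA.
by rewrite /= !inE !negb_or jk !(eq_sym i) !ijk// !inE eqxx ?orbT.
Qed.

Lemma cards3 i j k : uniq [:: i; j; k] -> #|[set i; j; k]%SET| = 3%N.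
Proof.
rewrite /= !inE negb_or andbT => /andP[/andP[ij ik] jk].
by rewrite finset.setUC cardsU1 cards2 !inE ij negb_or !(eq_sym k) ik jk.
Qed.

Lemma card_setC3 T : #|T| = 3%N -> #|~: T| = (#|K| - 3)%N.
Proof. by move=> cT; rewrite cardsCs finset.setCK cT. Qed.

(** The default [(0, 0)] is taken only when no point is equidistant from all of [T]; [sqdist_center]
    excludes this for triples. *)
Definition center T : R * R := xget (0, 0)
  (fun o => forall i j, i \in T -> j \in T -> sqdist o (pos i) = sqdist o (pos j)).

Lemma sqdist_center T i j : #|T| = 3%N -> i \in T -> j \in T ->
  sqdist (center T) (pos i) = sqdist (center T) (pos j).
Proof.
move=> /cards3E[a [b [c [u ->]]]]; rewrite /center.
have [z [h1 h2]] := exists_circumcenter (no_collinear u).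
have ex : exists o, forall i j, i \in [set a; b; c]%SET -> j \in [set a; b; c]%SET ->
    sqdist o (pos i) = sqdist o (pos j).
  exists z => i' j'; rewrite !inE -!orbA.
  by move=> /or3P[] /eqP-> /or3P[] /eqP->; rewrite -?h1 -?h2.
by have := xgetPex (0, 0) ex; apply.
Qed.

(** Quantifying over [T] avoids choosing a point on the circle; for a triple any one point decides,
    by [insideE]. *)
Definition inside T i := [forall (j | j \in T),
  sqdist (center T) (pos i) < sqdist (center T) (pos j)].

Definition num_inside T : nat := #|[set i | inside T i]%SET|.

Lemma insideE T i j : #|T| = 3%N -> j \in T ->
  inside T i = (sqdist (center T) (pos i) < sqdist (center T) (pos j)).
Proof.
move=> cT jT; apply/forall_inP/idP => [/(_ j jT)//|h k kT].
by rewrite (sqdist_center cT kT jT).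
Qed.

Lemma inside_notin T i : #|T| = 3%N -> inside T i -> i \notin T.
Proof.
by move=> cT; apply: contraL => iT; rewrite (insideE _ cT iT) ltxx.
Qed.

Lemma cocircular_mem T i j : #|T| = 3%N -> j \in T ->
  sqdist (center T) (pos i) = sqdist (center T) (pos j) -> i \in T.
Proof.
move=> cT jT e; apply: contraT => iT.
have : (#|i |: T| <= 3)%N; last by rewrite cardsU1 iT cT.
apply: (@no_cocircular (center T) (sqdist (center T) (pos j))) => m.
rewrite in_setU1 => /predU1P[->//|mT]; exact: sqdist_center.
Qed.

Lemma outside_lt T i j : #|T| = 3%N -> j \in T -> i \notin T -> ~~ inside T i ->
  sqdist (center T) (pos j) < sqdist (center T) (pos i).
Proof.
move=> cT jT iT; rewrite (insideE _ cT jT) -leNgt lt_neqAle => ->.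
by rewrite andbT; apply: contra iT => /eqP /esym /(cocircular_mem cT jT).
Qed.

Lemma num_inside_le T : #|T| = 3%N -> (num_inside T <= #|K| - 3)%N.
Proof.
move=> cT; rewrite -(card_setC3 cT); apply: subset_leq_card.
by apply/fintype.subsetP => i; rewrite !inE => /(inside_notin cT).
Qed.

Lemma inside_in_circ T i a b c : uniq [:: a; b; c] -> T = [set a; b; c]%SET ->
  inside T i -> in_circ (pos i) (pos a) (pos b) (pos c).
Proof.
move=> u TE; have cT : #|T| = 3%N by rewrite TE cards3.
have [aT bT cT'] : [/\ a \in T, b \in T & c \in T].
  by rewrite TE !inE !eqxx !orbT.
rewrite (insideE _ cT aT) => h.
by exists (center T); split => //; exact: sqdist_center.
Qed.

Definition meets i j k l : Prop := segments_meet (pos i) (pos j) (pos k) (pos l).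

Definition crossed Q : bool := `[< exists i j k l,
  [/\ uniq [:: i; j; k; l], Q = [set i; j; k; l]%SET & meets i j k l] >].

(** If two points [i], [j] of [Q] are inside the circles of the other three, [two_in_circ] makes [Q]
    crossed and excludes the two remaining points, so the count is at most 2. *)
Lemma card_inside_le Q : #|Q| = 4%N ->
  (#|[set i in Q | inside (Q :\ i) i]%SET| <= 1 + crossed Q)%N.
Proof.
move=> cQ; set I := [set i in _ | _]%SET.
have [|/card_gt1P[i [j [iI jI ij]]]] := leqP #|I| 1.
  by move/leq_trans; apply; rewrite leq_addr.
move: (iI) (jI); rewrite !inE => /andP[iQ ini] /andP[jQ inj].
have : #|Q :\ i :\ j| == 2%N.
  have := cardsD1 i Q; rewrite iQ cQ add1n => -[c3].
  by have := cardsD1 j (Q :\ i); rewrite -c3 !inE eq_sym ij jQ add1n => -[<-].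
case/cards2P => k [l [kl e]].
have mem x : x \in [set k; l]%SET -> [/\ x != j, x != i & x \in Q].
  by rewrite -e !inE => /and3P[].
have [kj ki kQ] := mem k ltac:(by rewrite !inE eqxx).
have [lj li lQ] := mem l ltac:(by rewrite !inE eqxx orbT).
have QE : Q = [set i; j; k; l]%SET.
  apply/setP => x; move/setP/(_ x): e; rewrite !inE.
  have [->|_] /= := eqVneq x i; first by rewrite iQ.
  have [->|_] /= := eqVneq x j; first by rewrite jQ.
  by move=> ->.
have Qi : Q :\ i = [set j; k; l]%SET.
  apply/setP => x; rewrite QE !inE; case: (eqVneq x i) => [->|] //=.
  by rewrite (negbTE ij) !(eq_sym i) (negbTE ki) (negbTE li).
have Qj : Q :\ j = [set i; k; l]%SET.
  apply/setP => x; rewrite QE !inE; case: (eqVneq x j) => [->|] //=.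
    by rewrite !(eq_sym j) (negbTE ij) (negbTE kj) (negbTE lj).
  by rewrite orbF.
have Qk : Q :\ k = [set i; j; l]%SET.
  apply/setP => x; rewrite QE !inE; case: (eqVneq x k) => [->|] //=.
    by rewrite (negbTE ki) (negbTE kj) (negbTE kl).
  by rewrite orbF.
have Ql : Q :\ l = [set i; j; k]%SET.
  apply/setP => x; rewrite QE !inE; case: (eqVneq x l) => [->|] //=.
    by rewrite (negbTE li) (negbTE lj) eq_sym (negbTE kl).
  by rewrite orbF.
have ux x y z : x != y -> x != z -> y != z -> uniq [:: x; y; z].
  by move=> h1 h2 h3; rewrite /= !inE negb_or h1 h2 h3.
have [ik il jk jl] : [/\ i != k, i != l, j != k & j != l].
  by rewrite ![_ == k]eq_sym ![_ == l]eq_sym.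
have [m nk nl] : [/\ meets i j k l,
    ~ in_circ (pos k) (pos i) (pos j) (pos l) &
    ~ in_circ (pos l) (pos i) (pos j) (pos k)].
  apply: two_in_circ; rewrite ?(inj_eq pos_inj)//; try by apply: no_collinear; exact: ux.
  - by apply: (inside_in_circ _ Qi ini); exact: ux.
  - by apply: (inside_in_circ _ Qj inj); exact: ux.
have -> : crossed Q.
  apply/asboolP; exists i, j, k, l; split => //.
  by rewrite /= !inE !negb_or ij ik il jk jl kl.
apply: (@leq_trans #|[set i; j]%SET|); last by rewrite cards2 ij.
apply: subset_leq_card; apply/fintype.subsetP => x; rewrite !inE {1}QE !inE -!orbA.
case/andP => /or4P[] /eqP->; rewrite ?eqxx ?orbT//.
- by move=> /(inside_in_circ (ux _ _ _ _ ij il jl) Qk).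
- by move=> /(inside_in_circ (ux _ _ _ _ ij ik jk) Ql).
Qed.

(** Double counting: a pair of a triple [T] and a point [i] inside its circle corresponds to the
    four-set [i |: T] with [i] marked. *)
Lemma sum_num_inside : (\sum_(T : {set K} | #|T| == 3%N) num_inside T =
  \sum_(Q : {set K} | #|Q| == 4%N) #|[set i in Q | inside (Q :\ i) i]%SET|)%N.
Proof.
under eq_bigr => T cT.
  rewrite /num_inside -sum1dep_card.
  under eq_bigl => i do rewrite -[inside T i](andb_idl (inside_notin (eqP cT))).
  rewrite big_mkcondr/=; over.
under [RHS]eq_bigr => Q _ do rewrite -sum1dep_card big_mkcondr/=.
rewrite !pair_big_dep /= (reindex_onto (fun p : {set K} * K => (p.1 :\ p.2, p.2))
  (fun p : {set K} * K => (p.2 |: p.1, p.2))) /=; last first.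
  by case=> T i /= /andP[_ iT]; rewrite finset.setU1K.
apply: eq_big => [[Q i]|[Q i] _] //=.
rewrite xpair_eqE eqxx andbT !inE eqxx /= andbT.
have [iQ|iQ] := boolP (i \in Q); last first.
  by rewrite andbF; apply/negP => /andP[_ /eqP h]; rewrite -h setU11 in iQ.
by rewrite finset.setD1K// eqxx !andbT -(eqn_add2l (i \in Q)) -cardsD1 iQ.
Qed.

Lemma sum_num_inside_le :
  (\sum_(T : {set K} | #|T| == 3%N) num_inside T
   <= 'C(#|K|, 4) + minn 'C(#|K|, 4)
        #|[set Q : {set K} | (#|Q| == 4%N) && crossed Q]%SET|)%N.
Proof.
rewrite sum_num_inside.
have /leq_trans : (\sum_(Q : {set K} | #|Q| == 4%N)
    #|[set i in Q | inside (Q :\ i) i]%SET| <=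
    \sum_(Q : {set K} | #|Q| == 4%N) (1 + crossed Q))%N.
  by apply: leq_sum => Q /eqP; exact: card_inside_le.
apply; rewrite big_split /= sum1dep_card card_draws leq_add2l.
rewrite leq_min; apply/andP; split.
  rewrite -card_draws -sum1dep_card; apply: leq_sum => Q _; exact: leq_b1.
rewrite -sum1dep_card big_mkcondr /=.
by apply: leq_sum => Q _; case: (crossed Q).
Qed.

(** The edge joins a leftmost point [i] to the point of least slope seen from [i]. *)
Lemma exists_hull_edge : (1 < #|K|)%N -> exists i j, i != j /\
  forall k, k != i -> k != j -> 0 < orient (pos i) (pos j) (pos k).
Proof.
move=> /card_gt1P[a [b [_ _ ab]]].
case: (@Order.TotalTheory.arg_minP _ _ _ a xpredT (fun i => (pos i).1)) => // i _ imin.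
have ux x y z : x != y -> x != z -> y != z -> uniq [:: x; y; z].
  by move=> h1 h2 h3; rewrite /= !inE negb_or h1 h2 h3.
have orient0 j k : j != i -> k != i -> k != j -> orient (pos i) (pos j) (pos k) != 0.
  by move=> ji ki kj; apply: no_collinear; apply: ux; rewrite // eq_sym.
(* When another point has the same abscissa as [i], the edge is vertical and its orientation depends
   on which end is higher. *)
case: (pselect (exists2 j, j != i & (pos j).1 = (pos i).1)) => [[j ji e]|nv].
  have h k : k != i -> k != j ->
      0 < (pos i).2 - (pos j).2 -> 0 < orient (pos i) (pos j) (pos k).
    move=> ki kj d; have := orient0 j k ji ki kj; rewrite /orient e subrr mul0r sub0r.
    have := imin k isT; rewrite -subr_ge0 oppr_eq0 mulf_eq0 negb_or.
    by rewrite le_eqVlt eq_sym => /orP[/eqP->|]; [rewrite eqxx andbF|nra].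
  have h' k : k != i -> k != j ->
      (pos i).2 - (pos j).2 < 0 -> 0 < orient (pos j) (pos i) (pos k).
    move=> ki kj d; have := orient0 j k ji ki kj; rewrite orient_swap.
    rewrite /orient e subrr mul0r sub0r opprK.
    have := imin k isT; rewrite -subr_ge0 mulf_eq0 negb_or.
    by rewrite le_eqVlt eq_sym => /orP[/eqP->|]; [rewrite eqxx andbF|nra].
  have [d|d|d] := ltgtP ((pos i).2 - (pos j).2) 0.
  - by exists j, i; split => // k kj ki; exact: h'.
  - by exists i, j; split; [rewrite eq_sym|move=> k ki kj; exact: h].
  - exfalso; move/eqP: ji; apply; apply: pos_inj.
    by move: e d; case: (pos i) (pos j) => [x y] [x' y'] /= -> /eqP; rewrite subr_eq0 => /eqP ->.
have lt1 k : k != i -> 0 < (pos k).1 - (pos i).1.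
  move=> ki; rewrite subr_gt0 lt_neqAle imin// andbT eq_sym; apply/eqP => e.
  by apply: nv; exists k.
have [c ci] : exists c, c != i.
  by have [ai|ai] := eqVneq a i; [exists b; rewrite -ai eq_sym|exists a].
pose slope k := ((pos k).2 - (pos i).2) / ((pos k).1 - (pos i).1).
case: (@Order.TotalTheory.arg_minP _ _ _ c (fun k => k != i) slope) => // j ji jmin.
exists i, j; split; first by rewrite eq_sym.
move=> k ki kj; rewrite lt_neqAle eq_sym orient0//=.
have := jmin k ki; rewrite /slope ler_pdivrMr ?lt1// mulrAC ler_pdivlMr ?lt1//.
by rewrite /orient; lra.
Qed.

(* Among the circles through a hull edge, the one for which the remaining
   points subtend the smallest angle encloses all the others. *)
Lemma exists_enclosing_triple : (2 < #|K|)%N ->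
  exists2 T : {set K}, #|T| == 3%N & num_inside T = (#|K| - 3)%N.
Proof.
move=> K3; have [i [j [ij hull]]] := exists_hull_edge (ltnW K3).
have [c /andP[ci cj]] : exists c, (c != i) && (c != j).
  have : (0 < #|~: [set i; j]%SET|)%N by rewrite cardsCs finset.setCK cards2 ij subn_gt0.
  by case/card_gt0P => c; rewrite !inE negb_or; exists c.
pose f x := (x.1 - (pos i).1) * (x.1 - (pos j).1)
          + (x.2 - (pos i).2) * (x.2 - (pos j).2).
(* [h k] is minus the cotangent of the angle under which the edge is seen from [k], so minimising
   [h] selects the smallest angle. *)
pose h k := - (f (pos k) / orient (pos i) (pos j) (pos k)).
case: (@Order.TotalTheory.arg_minP _ _ _ c (fun k => (k != i) && (k != j)) h).
  by rewrite ci cj.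
move=> k /andP[ki kj] kmin; pose T := [set i; j; k]%SET.
have cT : #|T| = 3%N by apply: cards3; rewrite /= !inE negb_or ij !(eq_sym _ k) ki kj.
have [iT jT kT] : [/\ i \in T, j \in T & k \in T] by rewrite !inE !eqxx !orbT.
exists T; first by rewrite cT.
apply/eqP; rewrite eqn_leq num_inside_le//=.
rewrite -(card_setC3 cT); apply: subset_leq_card; apply/fintype.subsetP => l; rewrite !inE.
rewrite !negb_or => /andP[/andP[li lj] lk].
rewrite (insideE _ cT iT) lt_neqAle; apply/andP; split.
  apply/eqP => /(cocircular_mem cT iT).
  by rewrite !inE (negbTE li) (negbTE lj) (negbTE lk).
have ok := hull k ki kj; have ol := hull l li lj.
rewrite -subr_le0 -(pmulr_rle0 _ ok).
rewrite -(@incircle_center _ (center T) (0, 0) (pos l) (pos i) (pos j) (pos k))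
  ?(sqdist_center cT jT iT) ?(sqdist_center cT kT iT)//.
rewrite incircle_diameter -/(f (pos l)) -/(f (pos k)).
have := kmin l; rewrite li lj => /(_ isT); rewrite /h lerN2.
by rewrite ler_pdivrMr// mulrAC ler_pdivlMr//; lra.
Qed.
End PointConfiguration.

(** * Vertices of the order-k Voronoi diagram *)

Section NearestSets.
Variables (R : realType) (K : finType) (f : K -> R) (k : nat).
Implicit Types A B C D : {set K}.

(** The inequality is weak: ties are allowed, so that several such sets coexist at a boundary point
    of the diagram. *)
Definition nearest_set A := #|A| = k /\
  forall i j, i \in A -> j \notin A -> f i <= f j.

Definition squeezed (d : R) A :=
  (forall i, f i < d -> i \in A) /\ (forall i, i \in A -> f i <= d).

(* Two different sets of k nearest points differ by points at one distance d;
   each contains everything closer than d and nothing farther. *)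
Lemma nearest_sets_exchange A B : nearest_set A -> nearest_set B -> A <> B ->
  exists a b, [/\ a \in A, b \notin A, f a = f b, squeezed (f a) A & squeezed (f a) B].
Proof.
move=> [cA hA] [cB hB] AB.
have ex A' B' : #|A'| = k -> #|B'| = k -> A' <> B' -> exists2 a, a \in A' & a \notin B'.
  move=> cA' cB' AB'; apply: contrapT => h; apply: AB'; apply/eqP.
  rewrite eqEcard cA' cB' leqnn andbT; apply/fintype.subsetP => a aA.
  by apply: contrapT => aB; apply: h; exists a => //; apply/negP.
have [a aA aB] := ex _ _ cA cB AB.
have [b bB bA] := ex _ _ cB cA (nesym AB).
have fab : f a = f b by apply/le_anti; rewrite hA// hB.
exists a, b; split => //; split => i.
- by move=> lt; apply: contraLR lt => iA; rewrite -leNgt; exact: hA.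
- by rewrite fab => iA; exact: hA.
- by rewrite fab => lt; apply: contraLR lt => iB; rewrite -leNgt; exact: hB.
- by move=> iB; exact: hB.
Qed.

(** All three sets consist of the points [I] closer than a common [d] and of [k - #|I|] points of
    the level set [O]. Three choices require ['C(#|O|, k - #|I|) >= 3] with [#|O| <= 3], hence
    [#|O| = 3] and [k - #|I|] equal to 1 or 2. *)
Lemma three_nearest_sets A B C : nearest_set A -> nearest_set B -> nearest_set C ->
  A <> B -> B <> C -> A <> C ->
  (forall d, #|[set i | f i == d]%SET| <= 3)%N ->
  exists d, #|[set i | f i == d]%SET| = 3%N /\
    ((#|[set i | f i < d]%SET|).+1 = k \/ (#|[set i | f i < d]%SET|).+2 = k).
Proof.
move=> nA nB nC AB BC AC lev.
have [a [b [aA bA fab sA sB]]] := nearest_sets_exchange nA nB AB.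
have [a' [b' [aA' bA' fab' sA' sC]]] := nearest_sets_exchange nA nC AC.
(* Both exchanges involve [A], whose largest value is [f a] and also [f a']. *)
have e : f a' = f a.
  apply/eqP; rewrite eq_le sA.2//= leNgt; apply/negP => lt.
  by have := sA'.2 a aA; rewrite leNgt lt.
rewrite {}e in sC {sA'}; set d := f a in sA sB sC.
pose I := [set i | f i < d]%SET; pose O := [set i | f i == d]%SET.
have splitE D : squeezed d D -> D = I :|: (O :&: D).
  move=> [D1 D2]; apply/setP => i; rewrite !inE.
  case: ltgtP => //= [/D1->//|lt].
  by apply/negP => /D2; rewrite leNgt lt.
have kI D : #|D| = k -> squeezed d D -> (#|I| <= k)%N.
  move=> <- [D1 _]; apply: subset_leq_card.
  by apply/fintype.subsetP => i; rewrite inE => /D1.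
pose P := [set X : {set K} | X \subset O & #|X| == (k - #|I|)%N]%SET.
have sub D : #|D| = k -> squeezed d D -> O :&: D \in P.
  move=> cD sD; rewrite inE finset.subsetIl /= -cD [in #|D|](splitE D)// cardsU.
  rewrite (_ : I :&: _ = finset.set0) ?cards0 ?subn0 ?addKn//.
  by apply/setP => i; rewrite !inE; case: ltgtP.
have neq D D' : squeezed d D -> squeezed d D' -> D <> D' -> O :&: D != O :&: D'.
  by move=> sD sD' DD'; apply/eqP => h; apply: DD'; rewrite (splitE D)// (splitE D')// h.
have [cA _] := nA; have [cB _] := nB; have [cC _] := nC.
have draws : (2 < 'C(#|O|, k - #|I|))%N.
  rewrite -cards_draws; apply/card_gt2P; exists (O :&: A), (O :&: B), (O :&: C).
  by split; [split; exact: sub|split; [exact: neq|exact: neq|exact: neq (nesym AC)]].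
have O3 := lev d; have Ik := kI A cA sA.
exists d; rewrite -/I -/O; rewrite -/O in O3; move: O3 draws.
case: #|O| => [|[|[|[|//]]]] _;
  case mE : (k - #|I|)%N => [|[|[|[|x]]]] // _; split => //; lia.
Qed.
End NearestSets.

Section VoronoiVertices.
Variables (R : realType) (S : {fset R * R}).
Hypothesis genS : general_position S.
Let pos (i : S) : R * R := val i.
Implicit Types (i j : S) (A T : {set S}) (x y : R * R).

(** Counting takes place in the finite type of sites, whereas the cells are indexed by finite sets
    of points of the plane. *)
Definition fset_of A : {fset R * R} := [fset val i | i in A].

Lemma in_fset_of A i : (val i \in fset_of A) = (i \in A).
Proof. by rewrite (mem_imfset _ _ val_inj). Qed.

Lemma fset_ofP A p : reflect (exists2 i, i \in A & p = val i) (p \in fset_of A).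
Proof. exact: imfsetP. Qed.

Lemma fset_of_sub A : fset_of A `<=` S.
Proof. by apply/fsubsetP => p /fset_ofP[i _ ->]; exact: valP. Qed.

Lemma card_fset_of A : #|` fset_of A| = #|A|.
Proof.
rewrite -(card_fsub (fset_of_sub A)); apply: eq_card => i.
by rewrite in_fsub in_fset_of.
Qed.

Lemma pos_inj : injective pos. Proof. exact: val_inj. Qed.

Lemma pos_no_collinear i j k : uniq [:: i; j; k] ->
  orient (pos i) (pos j) (pos k) != 0.
Proof.
move=> u; apply/eqP => o0; case: genS => noc _.
apply: (noc (fset_of [set i; j; k]%SET)); first exact: fset_of_sub.
  by rewrite card_fset_of cards3.
pose p := pos i; pose q := pos j; pose r := pos k.
(* The line through [p] and [q]; its normal is [q - p] turned by a right angle. *)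
exists (- (q.2 - p.2)), (q.1 - p.1), (- (q.2 - p.2) * p.1 + (q.1 - p.1) * p.2).
split=> [[/eqP]|s /fset_ofP[l]].
  rewrite oppr_eq0 subr_eq0 => /eqP e2 /eqP; rewrite subr_eq0 => /eqP e1.
  move: u; rewrite /= inE negb_or => /andP[/andP[/eqP ij _] _]; apply: ij.
  by apply: pos_inj; move: e1 e2; rewrite -/p -/q; case: (p) (q) => [a b] [c d] /= -> ->.
rewrite !inE -!orbA => /or3P[] /eqP-> -> //; rewrite -/p -/q -/r.
  by ring.
by move: o0; rewrite /orient -/p -/q -/r /= => ?; lra.
Qed.

Lemma pos_no_cocircular o (d : R) A :
  (forall i, i \in A -> sqdist o (pos i) = d) -> (#|A| <= 3)%N.
Proof.
move=> h; rewrite leqNgt; apply/negP => c4; case: genS => _.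
have [B BA cB] : exists2 B : {set S}, B \subset A & #|B| = 4%N.
  have := cards_draws A 4; have : (0 < 'C(#|A|, 4))%N by rewrite bin_gt0.
  move=> /[swap] <- /card_gt0P[B]; rewrite inE => /andP[BA /eqP cB].
  by exists B.
move/(_ (fset_of B)); apply; first exact: fset_of_sub.
  by rewrite card_fset_of.
exists o, (Num.sqrt d) => p /fset_ofP[i iB ->].
by rewrite /edist -(h i (fintype.subsetP BA i iB)); congr Num.sqrt; exact: sqdistC.
Qed.

Let noc := pos_no_collinear.
Let nocirc := pos_no_cocircular.

Lemma voronoi_cellP k A y : voronoi_cell S k (fset_of A) y <->
  #|A| = k /\ forall i j, i \in A -> j \notin A ->
    sqdist y (pos i) < sqdist y (pos j).
Proof.
rewrite /voronoi_cell /= card_fset_of; split=> [[_ [-> h]]|[-> h]].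
  split => // i j iA jA; rewrite -ltr_edist; apply: h.
  - by rewrite in_fset_of.
  - exact: valP.
  - by rewrite in_fset_of.
split; first exact: fset_of_sub.
split => // p q /fset_ofP[i iA ->] qS; rewrite -[q]/(val [` qS]) in_fset_of => jA.
by rewrite ltr_edist; exact: (h i [` qS]).
Qed.

(** The squares of the coordinates of [y] cancel, leaving a closed half-plane. *)
Lemma closed_sqdist_le p q : closed [set y : R * R | sqdist y p <= sqdist y q].
Proof.
pose g y : R := y.1 * (2 * (q.1 - p.1)) + y.2 * (2 * (q.2 - p.2)).
have gc : continuous g.
  move=> y; apply: cvgD; apply: cvgMl.
    exact: cvg_fst.
  exact: cvg_snd.
pose c : R := q.1 ^+ 2 + q.2 ^+ 2 - p.1 ^+ 2 - p.2 ^+ 2.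
rewrite (_ : [set y | _] = g @^-1` [set t | t <= c]).
  by have /continuous_closedP := gc; apply; exact: closed_le.
by apply/seteqP; split => y /=; rewrite /sqdist /g /c; lra.
Qed.

(** Strict comparisons of distances become weak ones in the limit. *)
Lemma closure_voronoi_cell k F x : closure (voronoi_cell S k F) x ->
  exists2 A, F = fset_of A & nearest_set (fun i => sqdist x (pos i)) k A.
Proof.
move=> cl.
have [y [[sub [card _]] _]] := cl setT filterT.
have AE : F = fset_of [set i : S | val i \in F]%SET.
  apply/fsetP => p; apply/idP/fset_ofP => [hp| [m]]; last by rewrite inE => ? ->.
  by exists [` fsubsetP sub p hp]; rewrite ?inE.
exists [set i : S | val i \in F]%SET => //.
split=> [|i j iA jA]; first by rewrite -card_fset_of -AE.
suff : [set y | sqdist y (pos i) <= sqdist y (pos j)] x by [].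
rewrite [X in X x](closure_id _).1; last exact: closed_sqdist_le.
apply: closure_subset cl => z; rewrite AE => /voronoi_cellP[_ h] /=.
exact/ltW/h.
Qed.

(** Three cells give three nearest sets, hence three sites at one distance [d] from [x]; so [x] is
    their circumcentre and the sites closer than [d] are those inside the circle. *)
Lemma voronoi_vertex_center k x : voronoi_vertices S k x ->
  exists T, [/\ #|T| = 3%N, x = center pos T &
    (num_inside pos T).+1 = k \/ (num_inside pos T).+2 = k].
Proof.
move=> [A' [B' [C' [[AB BC AC] [clA clB clC]]]]].
have [A AE nA] := closure_voronoi_cell clA.
have [B BE nB] := closure_voronoi_cell clB.
have [C CE nC] := closure_voronoi_cell clC.
have neq D D' : fset_of D <> fset_of D' -> D <> D' by move=> h e; rewrite e in h.
rewrite AE BE CE in AB BC AC.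
have lev d : (#|[set i | sqdist x (pos i) == d]%SET| <= 3)%N.
  by apply: (nocirc (o := x) (d := d)) => i; rewrite inE => /eqP.
have [d [T3 hk]] :=
  three_nearest_sets nA nB nC (neq _ _ AB) (neq _ _ BC) (neq _ _ AC) lev.
set T := [set i | _]%SET in T3; exists T.
have inT i : (i \in T) = (sqdist x (pos i) == d) by rewrite inE.
have xE : x = center pos T.
  have [a [b [c [u TE]]]] := cards3E T3.
  have [aT bT cT] : [/\ a \in T, b \in T & c \in T] by rewrite TE !inE !eqxx !orbT.
  apply: (circumcenter_unique (noc u)).
  - by move: aT bT; rewrite !inT => /eqP-> /eqP->.
  - by move: aT cT; rewrite !inT => /eqP-> /eqP->.
  - exact: sqdist_center.
  - exact: sqdist_center.
split => //; rewrite /num_inside.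
have /card_gt0P[a aT] : (0 < #|T|)%N by rewrite T3.
rewrite (_ : [set i | inside pos T i]%SET = [set i | sqdist x (pos i) < d]%SET)//.
apply/setP => i; rewrite !inE (insideE noc _ T3 aT) -xE.
by move: aT; rewrite inT => /eqP->.
Qed.

(** Along [v] the difference of two squared distances is affine in the step [e]: strict inequalities
    survive small steps, and ties are broken by the scalar product with [v]. *)
Lemma closure_cell_direction k A x (v : R * R) : #|A| = k ->
  (forall i j, i \in A -> j \notin A ->
     sqdist x (pos i) < sqdist x (pos j) \/
     sqdist x (pos i) = sqdist x (pos j) /\
       0 < v.1 * ((pos i).1 - (pos j).1) + v.2 * ((pos i).2 - (pos j).2)) ->
  closure (voronoi_cell S k (fset_of A)) x.
Proof.
move=> cA h U nU.
pose y (e : R) : R * R := (x.1 + e * v.1, x.2 + e * v.2).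
have yx : y e @[e --> 0^'+] --> x.
  have lim (a b : R) : a + e * b @[e --> 0^'+] --> a.
    rewrite -[X in _ --> X]addr0 -{2}(mul0r b).
    apply: cvgD; first exact: cvg_cst.
    by apply: cvgMr_tmp; apply: cvg_at_right_filter; exact: cvg_id.
  by rewrite (surjective_pairing x); exact: (cvg_pair (lim _ _) (lim _ _)).
have near_cell : \forall e \near 0^'+, voronoi_cell S k (fset_of A) (y e).
  have : \forall e \near 0^'+, forall ij : S * S, ij.1 \in A -> ij.2 \notin A ->
      sqdist (y e) (pos ij.1) < sqdist (y e) (pos ij.2).
    apply: filter_forall => -[i j] /=.
    have [iA|iA] := boolP (i \in A); last by apply: nearW.
    have [jA|jA] := boolP (j \in A); first by apply: nearW.
    have dE e : sqdist (y e) (pos j) - sqdist (y e) (pos i) =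
        sqdist x (pos j) - sqdist x (pos i) + e * (2 *
        (v.1 * ((pos i).1 - (pos j).1) + v.2 * ((pos i).2 - (pos j).2))).
      by rewrite /sqdist /y /=; ring.
    move: (h i j iA jA) dE; set w := v.1 * _ + _; set dl := sqdist x (pos j) - _.
    move=> hw dE; case: hw => [lt|[eq w0]]; last first.
      near=> e; move=> _ _; rewrite -subr_gt0 dE /dl eq subrr add0r.
      by rewrite mulr_gt0// mulr_gt0.
    have dl0 : 0 < dl by rewrite subr_gt0.
    (* Adding 1 keeps the bound on the step defined when [w = 0]. *)
    have m0 : 0 < 2 * `|w| + 1 by rewrite ltr_wpDl// mulr_ge0.
    near=> e; move=> _ _; rewrite -subr_gt0 dE.
    have e0 : 0 < e by near: e; exact: nbhs_right_gt.
    have : e < dl / (2 * `|w| + 1) by near: e; apply: nbhs_right_lt; rewrite divr_gt0.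
    rewrite ltr_pdivlMr// => he.
    have : - (e * `|w|) <= e * w by rewrite -mulrN ler_pM2l// lerNl ler_normr lexx orbT.
    by move=> ?; lra.
  apply: filterS => e he; apply/voronoi_cellP; split=> // i j.
  exact: (he (i, j)).
have [e [c1 c2]] := @filter_ex _ (0^'+) _ _ (filterI near_cell (yx _ nU)).
by exists (y e).
Unshelve. all: by end_near. Qed.

Let x T := center pos T.
Let I T := [set i | inside pos T i]%SET.

(* A small step from the centre brings the site a closer than b and c, or
   leaves it farther than both. *)
Lemma nearest_closure_cells T a b c : uniq [:: a; b; c] -> T = [set a; b; c]%SET ->
  closure (voronoi_cell S (num_inside pos T).+1 (fset_of (a |: I T))) (x T) /\
  closure (voronoi_cell S (num_inside pos T).+2 (fset_of ([set b; c]%SET :|: I T))) (x T).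
Proof.
move=> u TE; have cT : #|T| = 3%N by rewrite TE cards3.
have [aT bT cT'] : [/\ a \in T, b \in T & c \in T] by rewrite TE !inE !eqxx !orbT.
have inI i : (i \in I T) = inside pos T i by rewrite inE.
have notI i : i \in T -> i \notin I T.
  by move=> iT; rewrite inI; apply: contraL iT; exact: inside_notin.
have eqT i j : i \in T -> j \in T -> sqdist (x T) (pos i) = sqdist (x T) (pos j).
  exact: sqdist_center.
have far i j : i \in T -> j \notin T -> j \notin I T ->
    sqdist (x T) (pos i) < sqdist (x T) (pos j).
  by move=> iT jT; rewrite inI; exact: outside_lt.
have near i j : i \in I T -> j \notin I T -> sqdist (x T) (pos i) < sqdist (x T) (pos j).
  move=> iI jI; apply: (@lt_le_trans _ _ (sqdist (x T) (pos a))).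
    by move: iI; rewrite inI (insideE noc _ cT aT).
  have [jT|jT] := boolP (j \in T); first by rewrite (eqT a j).
  exact/ltW/far.
have memT i : i \in T -> [\/ i = a, i = b | i = c].
  by rewrite TE !inE -!orbA => /or3P[] /eqP; [constructor 1|constructor 2|constructor 3].
split.
- have [v [v1 v2]] := exists_direction 1 1 (noc u).
  apply: (closure_cell_direction (v := v)); first by rewrite cardsU1 notI.
  move=> i j; rewrite !in_setU1 negb_or => /predU1P[->|iI] /andP[ja jI]; last first.
    by left; exact: near.
  have [jT|jT] := boolP (j \in T); last by left; exact: far.
  right; split; first exact: eqT.
  by case: (memT j jT) ja => ->; rewrite ?eqxx// => _; rewrite ?v1 ?v2.
- have [v [v1 v2]] := exists_direction (-1) (-1) (noc u).
  apply: (closure_cell_direction (v := v)).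
    rewrite cardsU cards2 (_ : _ :&: _ = finset.set0) ?cards0 ?subn0.
      by move: u; rewrite /= !inE => /and3P[_ -> _].
    apply/setP => i; rewrite finset.in_setI finset.in_set0 finset.in_set2; apply/negP.
    by move=> /andP[/orP[]/eqP->]; apply/negP; exact: notI.
  move=> i j; rewrite !finset.in_setU !finset.in_set1 negb_or => /orP[ibc|iI] /andP[jbc jI]; last first.
    by left; exact: near.
  have iT : i \in T by case/orP: ibc => /eqP->.
  have [jT|jT] := boolP (j \in T); last by left; exact: far.
  right; split; first exact: eqT.
  case: (memT j jT) jbc => ->; rewrite ?eqxx ?orbT// => _.
  by case/orP: ibc => /eqP->; lra.
Qed.

(** Rotating the triple yields three cells at its centre: [I T] together with one of the three
    points, or with two of them. *)
Lemma center_voronoi_vertex k T : #|T| = 3%N ->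
  (num_inside pos T).+1 = k \/ (num_inside pos T).+2 = k ->
  voronoi_vertices S k (x T).
Proof.
move=> cT hk; have [a [b [c [u TE]]]] := cards3E cT.
have u' : uniq [:: b; c; a] by rewrite -(rot_uniq 2).
have u'' : uniq [:: c; a; b] by rewrite -(rot_uniq 1).
have TE' : T = [set b; c; a]%SET by rewrite TE -finset.setUA finset.setUC.
have TE'' : T = [set c; a; b]%SET by rewrite TE finset.setUC finset.setUA.
have [a1 a2] := nearest_closure_cells u TE.
have [b1 b2] := nearest_closure_cells u' TE'.
have [c1 c2] := nearest_closure_cells u'' TE''.
have notI i : i \in T -> i \in I T = false.
  by move=> iT; rewrite inE; apply/negbTE; apply: contraL iT; exact: inside_notin.
have [aT bT cT'] : [/\ a \in T, b \in T & c \in T] by rewrite TE !inE !eqxx !orbT.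
have neq i A A' : i \in A -> i \notin A' -> fset_of A <> fset_of A'.
  by move=> iA iA' /fsetP/(_ (val i)); rewrite !in_fset_of iA (negbTE iA').
move: u; rewrite /= !inE negb_or andbT => /andP[/andP[ab ac] bc].
case: hk => <-.
- exists (fset_of (a |: I T)), (fset_of (b |: I T)), (fset_of (c |: I T)).
  split; split => //; [apply: (neq a)|apply: (neq b)|apply: (neq a)];
    by rewrite in_setU1 ?eqxx// notI// orbF.
- exists (fset_of ([set b; c]%SET :|: I T)), (fset_of ([set c; a]%SET :|: I T)),
    (fset_of ([set a; b]%SET :|: I T)).
  split; split => //; [apply: (neq b)|apply: (neq c)|apply: (neq c)];
    rewrite finset.in_setU finset.in_set2 ?eqxx ?orbT// notI// orbF negb_or.
  + by rewrite bc eq_sym ab.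
  + by rewrite !(eq_sym c) ac bc.
  + by rewrite !(eq_sym c) ac bc.
Qed.

(** The larger of two concentric discs contains the points inside the smaller one and the three on
    its circle. *)
Lemma num_inside_lt_radius T T' i i' : #|T| = 3%N -> #|T'| = 3%N -> i \in T -> i' \in T' ->
  x T = x T' -> sqdist (x T) (pos i) < sqdist (x T) (pos i') ->
  (num_inside pos T + 3 <= num_inside pos T')%N.
Proof.
move=> cT cT' iT iT' xx lt.
have <- : #|T :|: I T| = (num_inside pos T + 3)%N.
  rewrite cardsU cT addnC (_ : _ :&: _ = finset.set0) ?cards0 ?subn0//.
  apply/setP => j; rewrite !inE; apply/negP => /andP[jT].
  by move/(inside_notin noc cT)/negP.
apply: subset_leq_card; apply/fintype.subsetP => j; rewrite !inE.
rewrite (insideE noc _ cT iT) (insideE noc _ cT' iT') -/(x T) -/(x T') -xx.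
by move=> /orP[jT|/lt_trans]; [rewrite /x (sqdist_center noc cT jT iT)|apply].
Qed.

Definition order_triples k : {set {set S}} :=
  [set T : {set S} | (#|T| == 3%N) &&
     (((num_inside pos T).+1 == k) || ((num_inside pos T).+2 == k))]%SET.

(** At a fixed order the values of [num_inside] differ by at most 1, whereas concentric circles of
    different radii would make them differ by at least 3. With equal radii the triples are
    cocircular, hence equal. *)
Lemma center_inj k : {in order_triples k &, injective x}.
Proof.
move=> T T'; rewrite !inE => /andP[/eqP cT hT] /andP[/eqP cT' hT'] xx.
have /card_gt0P[i iT] : (0 < #|T|)%N by rewrite cT.
have /card_gt0P[i' iT'] : (0 < #|T'|)%N by rewrite cT'.
have [lt|lt|e] := ltgtP (sqdist (x T) (pos i)) (sqdist (x T) (pos i')).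
- by have := num_inside_lt_radius cT cT' iT iT' xx lt; lia.
- rewrite xx in lt.
  by have := num_inside_lt_radius cT' cT iT' iT (esym xx) lt; lia.
- apply/esym/eqP; rewrite eqEcard cT cT' leqnn andbT.
  apply/fintype.subsetP => j jT'; apply: (cocircular_mem noc nocirc cT iT).
  by rewrite -/(x T) e xx; exact: sqdist_center.
Qed.

Lemma num_voronoi_verticesE k : num_voronoi_vertices S k = #|order_triples k|.
Proof.
rewrite /num_voronoi_vertices.
(* Writing the vertices as an explicit finite set also ensures that [fset_set] does not return its
   default value. *)
rewrite (_ : voronoi_vertices S k = [set` [fset x T | T in order_triples k]]).
  rewrite set_fsetK card_in_imfset; last exact: center_inj.
  by rewrite cardE; apply/perm_size/uniq_perm; rewrite ?enum_finmem_uniq ?enum_uniq// => T; rewrite enum_finmemE mem_enum.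
apply/seteqP; split => z /=.
  move=> /voronoi_vertex_center[T [cT -> hk]]; apply/imfsetP; exists T => //=.
  by rewrite inE cT eqxx /=; apply/orP; case: hk => ->; [left|right].
case/imfsetP => T /=; rewrite inE => /andP[/eqP cT hk] ->.
apply: center_voronoi_vertex => //.
by case/orP: hk => /eqP; [left|right].
Qed.

(** A triple with [i] points inside contributes ['X^i] at order [i + 1] and ['X^(i + 1)] at order
    [i + 2]. *)
Lemma voronoi_polyE : voronoi_poly S =
  (1 + 'X) * \sum_(T : {set S} | #|T| == 3%N) 'X^(num_inside pos T).
Proof.
rewrite /voronoi_poly.
have nE : #|{: S}| = #|` S| by rewrite -cardfE.
transitivity (\sum_(1 <= k < #|` S|) \sum_(T : {set S} | #|T| == 3%N)
   ((if k == (num_inside pos T).+1 then 'X^(num_inside pos T) else 0)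
   + (if k == (num_inside pos T).+2 then 'X^((num_inside pos T).+1) else 0) : {poly R[i]})).
  apply: eq_bigr => k _; rewrite num_voronoi_verticesE -sum1dep_card natr_sum.
  rewrite scaler_suml big_mkcondr /=; apply: eq_bigr => T _.
  rewrite !(eq_sym k); have [<-|ne] /= := eqVneq (num_inside pos T).+1 k.
    by rewrite scale1r gtn_eqF// addr0.
  by rewrite add0r; case: eqP => [<-|_]; rewrite ?scale1r.
rewrite exchange_big mulr_sumr /=; apply: eq_bigr => T /eqP cT.
have le3 : (3 <= #|` S|)%N by rewrite -nE -cT max_card.
have := num_inside_le noc cT; rewrite nE leq_subRL// => le.
rewrite big_split /= -!big_mkcond /= !big_nat1_eq /=.
(* Both orders lie below [#|] S|[because]i + 3 <= #|[S|]. *)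
rewrite (ltnW le : ((num_inside pos T).+1 < _)%N) (le : ((num_inside pos T).+2 < _)%N).
by rewrite mulrDl mul1r exprS.
Qed.

(** The map [g] sends a pair of edges to its set of endpoints, and every crossed four-set is the
    image of its crossing pair. *)
Lemma crossed_le :
  (#|[set Q : {set S} | (#|Q| == 4%N) && crossed pos Q]%SET| <= crossing_number S)%N.
Proof.
pose g (P : {fset {fset R * R}}) : {set S} :=
  [set i : S | `[< exists2 e, e \in P & val i \in e >]]%SET.
rewrite /crossing_number cardE -(size_map g).
apply: uniq_leq_size (enum_uniq _) _ => Q; rewrite mem_enum inE => /andP[_ /asboolP].
move=> [i [j [k [l [u QE [a [b [a01 b01 e1 e2]]]]]]]].
have eqv (i' j' : S) : (val i' == val j' :> R * R) = (i' == j') by rewrite (inj_eq val_inj).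
pose e := [fset val i; val j]; pose f := [fset val k; val l].
move: u; rewrite /= !inE !negb_or andbT => /and3P[/and3P[ij ik il] /andP[jk jl] kl].
have ee : e \in edges S.
  rewrite !inE fpowersetE cardfs2 eqv ij andbT.
  by apply/fsubsetP => p; rewrite !inE => /orP[]/eqP->; exact: valP.
have fe : f \in edges S.
  rewrite !inE fpowersetE cardfs2 eqv kl andbT.
  by apply/fsubsetP => p; rewrite !inE => /orP[]/eqP->; exact: valP.
have ef : e != f.
  apply/eqP => /fsetP/(_ (val i)); rewrite !inE !eqv eqxx /=.
  by rewrite (negbTE ik) (negbTE il).
apply/mapP; exists [fset e; f].
  rewrite !inE fpowersetE cardfs2 ef /=; apply/andP; split.
    by apply/fsubsetP => p; rewrite in_fset2 => /orP[]/eqP->.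
  apply/asboolP; exists e, f; split => //.
  exists ((1 - a) * (pos i).1 + a * (pos j).1, (1 - a) * (pos i).2 + a * (pos j).2).
  split; first by exists (val i), (val j), a.
  by exists (val k), (val l), b; rewrite e1 e2.
apply/setP => m; rewrite QE !inE; apply/idP/asboolP.
  rewrite -!orbA => /or4P[]/eqP->; [exists e|exists e|exists f|exists f];
    by rewrite !inE ?eqxx ?orbT.
by move=> [h]; rewrite !inE => /orP[]/eqP->; rewrite !inE !eqv => /orP[]->; rewrite ?orbT.
Qed.
End VoronoiVertices.

(** * From the crossing number to the root bound *)

(* Capping alpha at 1 avoids proving that alpha <= 1. *)
Lemma sum_num_inside_alpha (R : realType) (S : {fset R * R}) (alpha : R) :
  general_position S -> (3 < #|` S|)%N ->
  (crossing_number S)%:R = alpha * ('C(#|` S|, 4))%:R ->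
  4 * (\sum_(T : {set S} | #|T| == 3%N) (num_inside (fun i : S => val i) T)%:R) <=
  (1 + Num.min 1 alpha) * (#|` S| - 3)%:R * #|[pred T : {set S} | #|T| == 3%N]|%:R.
Proof.
move=> genS n3 cr.
have nE : #|{: S}| = #|` S| by rewrite -cardfE.
have c3 : #|[pred T : {set S} | #|T| == 3%N]| = 'C(#|` S|, 3).
  by rewrite -nE -card_draws cardsE.
have := sum_num_inside_le (@val_inj _ _ _) (pos_no_collinear genS).
rewrite nE => le.
have {}le : (\sum_(T : {set S} | #|T| == 3%N) num_inside (fun i : S => val i) T <=
    'C(#|` S|, 4) + minn 'C(#|` S|, 4) (crossing_number S))%N.
  apply: (leq_trans le); rewrite leq_add2l leq_min geq_minl /=.
  exact: (leq_trans (geq_minr _ _) (crossed_le S)).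
rewrite -natr_sum c3.
(* This identity turns the count of four-sets into [(n - 3)] times the number of triples. *)
have e4 : 4 * ('C(#|` S|, 4))%:R = (#|` S| - 3)%:R * ('C(#|` S|, 3))%:R :> R.
  by rewrite -!natrM mul_bin_left.
rewrite -mulrA -e4 mulrCA ler_pM2l//.
apply: (le_trans (_ : _ <= ('C(#|` S|, 4) + minn 'C(#|` S|, 4) (crossing_number S))%:R)).
  by rewrite ler_nat.
rewrite natrD mulrDl mul1r lerD2l minr_pMl// mul1r -cr.
by rewrite le_min !ler_nat geq_minl geq_minr.
Qed.

Theorem theorem13 (R : realType) :
  exists E : nat -> R,
    E =O_\oo (fun n : nat => (n%:R ^+ 4)^-1 : R) /\
    forall (n : nat) (S : {fset R * R}) (alpha : R),
      (3 < n)%N -> #|` S| = n -> general_position S ->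
      (crossing_number S)%:R = alpha * ('C(n, 4))%:R ->
      exists z : R[i], root (voronoi_poly S) z /\
        (1 + (1 - alpha) * pi ^+ 2 / (16 * (n - 3)%:R ^+ 2) + E n)%:C <= `|z|.
Proof.
(* For [n > 3] one has [n <= 4 (n - 3)], so the error [(pi / (2 (n - 3)))^4] is at most
   [(2 pi / n)^4]. *)
exists (fun n => - ((2 * pi) ^+ 4) * (n%:R ^+ 4)^-1); split.
  apply/eqO_exP; exists (`|(2 * pi) ^+ 4| + 1); first by rewrite ltr_wpDl.
  by near=> n; rewrite normrM normrN ler_wpM2r// lerDl ler01.
move=> n S alpha n3 cS genS cr.
have nE : #|{: S}| = n by rewrite -cS -cardfE.
pose d := (n - 3)%N; have d0 : (0 < d)%N by rewrite subn_gt0.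
have alpha0 : 0 <= alpha.
  have C0 : 0 < ('C(n, 4))%:R :> R by rewrite ltr0n bin_gt0.
  by rewrite -(pmulr_lge0 _ C0) -cr.
have [z [rz hz]] : exists z : R[i],
    root (\sum_(T in [pred T : {set S} | #|T| == 3%N]) 'X^(num_inside (fun i : S => val i) T)) z /\
    (1 + (1 - Num.min 1 alpha) * pi ^+ 2 / (16 * d%:R ^+ 2) - (pi / (2 * d%:R)) ^+ 4)%:C <= `|z|.
  apply: large_root_sum_Xn => //.
  - move=> T /eqP cT; rewrite /d -nE; apply: num_inside_le => //.
    exact: pos_no_collinear.
  - have [|T cT hT] := exists_enclosing_triple (@val_inj _ _ _) (pos_no_collinear genS) (pos_no_cocircular genS).
      by rewrite nE ltnW.
    by exists T => //; rewrite hT nE.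
  - by rewrite ge_min lexx le_min ler01 alpha0.
  - by have := sum_num_inside_alpha genS _ _ (alpha := alpha); rewrite cS; apply.
exists z; split; first by rewrite voronoi_polyE// rootM rz orbT.
apply: le_trans hz; rewrite lecR.
have dR : 0 < d%:R :> R by rewrite ltr0n.
have nR : 0 < n%:R :> R by rewrite ltr0n (leq_trans _ n3).
apply: lerD.
  (* Replacing [Num.min 1 alpha] by [alpha] can only lower the bound. *)
  rewrite lerD2l; apply: ler_wpM2r; first by rewrite invr_ge0 mulr_ge0 ?exprn_ge0.
  by apply: ler_wpM2r; rewrite ?exprn_ge0 ?pi_ge0// lerD2l lerN2 ge_min lexx orbT.
rewrite mulNr lerN2 -exprVn -exprMn ler_pXn2r ?nnegrE ?divr_ge0 ?mulr_ge0 ?pi_ge0//.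
rewrite ler_pdivrMr ?mulr_gt0// mulrAC ler_pdivlMr//.
have n4d : n%:R <= 4 * d%:R :> R by rewrite -natrM ler_nat /d; lia.
by have := pi_ge0 R; nra.
Unshelve. all: by end_near. Qed.
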